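(* Let $l,r\in H'$ and $\sigma\in\mathbb{R}^n_+$, and write $$\tilde u_\sigma^l=\sum_{j=1}^N\lambda_j^l\Lambda_j,\quad \lambda^l=(\lambda_j^l)_{j=1}^N\in\mathbb{R}^N,\qquad \tilde u_\sigma^r=\sum_{j=1}^N\lambda_j^r\Lambda_j,\quad \lambda^r=(\lambda_j^r)_{j=1}^N\in\mathbb{R}^N.$$ Then, with $F_{l,r}(\sigma):=r(\tilde u_\sigma^l)$, $$F_{l,r}(\sigma)=(\lambda^l)^TB_\sigma\lambda^r=(\lambda^l)^Ty^r\quad\text{and}\quad\frac{\partial}{\partial\sigma_i}F_{l,r}(\sigma)=-(\lambda^l)^TB_i\lambda^r,\quad i=1,\ldots,n.$$
   Context: Setting: $H$ is a real Hilbert space and $H'=\mathcal L(H,\mathbb{R})$ is its dual. Let $n\in\mathbb{N}$ and let $b_0,b_1,\ldots,b_n:\ H\times H\to\mathbb{R}$ be bounded, symmetric and positive semidefinite bilinear forms. For $\sigma=(\sigma_1,\ldots,\sigma_n)\in\mathbb{R}^n$ set $$b_\sigma(u,v):=b_0(u,v)+\sum_{i=1}^n\sigma_i\, b_i(u,v).$$ With $\mathbf 1:=(1,\ldots,1)^T\in\mathbb{R}^n$, it is assumed that there are constants $\beta,C>0$ with $C\|v\|^2\ge b_{\mathbf 1}(v,v)\ge\beta\|v\|^2$ for all $v\in H$. $\mathbb{R}^n_+$ denotes the set of all $\sigma\in\mathbb{R}^n$ with all entries strictly positive; for such $\sigma$ the form $b_\sigma$ is symmetric, bounded and coercive. Let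 $V\subset H$ be a finite-dimensional subspace (the finite element space) with basis $\Lambda_1,\ldots,\Lambda_N$. For $\sigma\in\mathbb{R}^n_+$ and $l\in H'$ (and likewise $r\in H'$), $\tilde u_\sigma^l\in V$ denotes the unique solution of $b_\sigma(\tilde u_\sigma^l,v)=l(v)$ for all $v\in V$. The stiffness matrix $B_\sigma\in\mathbb{R}^{N\times N}$ has $(j,k)$-th entry $b_\sigma(\Lambda_j,\Lambda_k)$, the pixel stiffness matrices $B_i\in\mathbb{R}^{N\times N}$ have $(j,k)$-th entry $b_i(\Lambda_j,\Lambda_k)$, and the load vector $y^r\in\mathbb{R}^N$ has $j$-th entry $r(\Lambda_j)$. *)

(* Defs.v *)
From HB Require Import structures.
From mathcomp Require Import all_boot all_order all_algebra.
From mathcomp Require Import sesquilinear.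
From mathcomp Require Import all_classical all_reals all_analysis.

Set Implicit Arguments.
Unset Strict Implicit.
Unset Printing Implicit Defensive.

Import Order.TTheory GRing.Theory Num.Theory.
Import numFieldNormedType.Exports.

Local Open Scope classical_set_scope.
Local Open Scope ring_scope.

Definition bounded_form (R : realType) (H : normedModType R)
    (b : H -> H -> R) : Prop :=
  exists M : R, forall u v : H, `|b u v| <= M * `|u| * `|v|.

Definition psd_form (R : realType) (H : lmodType R) (b : H -> H -> R) : Prop :=
  forall v : H, 0 <= b v v.

Definition param_form (R : realType) (H : lmodType R) (n : nat)
    (b0 : {symmetric H}) (b : 'I_n -> {symmetric H}) (sigma : 'cV[R]_n)
    (u v : H) : R :=
  b0 u v + \sum_i sigma i 0 * b i u v.

Definition is_basis (R : realType) (H : lmodType R) (N : nat)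
    (V : submodClosed H) (Lam : 'I_N -> H) : Prop :=
  [/\ forall j, Lam j \in V,
      forall c : 'I_N -> R,
        \sum_j c j *: Lam j = 0 -> forall j, c j = 0
    & forall v : H, v \in V -> exists c : 'I_N -> R, v = \sum_j c j *: Lam j].

Definition is_galerkin_solution (R : realType) (H : lmodType R)
    (V : submodClosed H) (a : H -> H -> R) (l : H -> R) (u : H) : Prop :=
  u \in V /\ forall v : H, v \in V -> a u v = l v.

(* The solution of the variational problem on V; it exists and is unique when
   a is a bilinear form that is positive definite on a finite-dimensional V and
   l is linear.  Without a solution, the value is 0 by convention. *)
Definition galerkin_solution (R : realType) (H : lmodType R)
    (V : submodClosed H) (a : H -> H -> R) (l : H -> R) : H :=
  xget 0 [set u : H | is_galerkin_solution V a l u].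

Definition stiffness_mx (R : realType) (H : lmodType R) (N : nat)
    (Lam : 'I_N -> H) (a : H -> H -> R) : 'M[R]_N :=
  \matrix_(j, k) a (Lam j) (Lam k).

Definition load_vec (R : realType) (H : lmodType R) (N : nat)
    (Lam : 'I_N -> H) (r : H -> R) : 'cV[R]_N :=
  \col_j r (Lam j).

(* F_{l,r} as a function on all of R^n; only its values at vectors with
   positive entries, an open set, are meaningful. *)
Definition measurement (R : realType) (H : lmodType R) (n : nat)
    (b0 : {symmetric H}) (b : 'I_n -> {symmetric H}) (V : submodClosed H)
    (l r : H -> R) (sigma : 'cV[R]_n) : R :=
  r (galerkin_solution V (param_form b0 b sigma) l).

(* Main.v *)
(* Let u, u' be the Galerkin solutions for l at sigma and sigma + h e_i, and w
   the one for r at sigma. By symmetry, r(u' - u) = b_sigma(w, u' - u), and the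
   equations of u and u' turn this into - h b_i(u', w). It remains to see that
   b_i(u', w) tends to b_i(u, w). The difference is the functional b_i(w, .)
   applied to u' - u, so the same identity, with z the Galerkin solution for
   b_i(w, .), makes it equal to - h b_i(u', z), and b_i(u', u') is bounded
   uniformly for |h| <= sigma_i / 2 because b_sigma, b_i are nonnegative. *)
Require Import Defs.
From HB Require Import structures.
From mathcomp Require Import all_boot all_order all_algebra.
From mathcomp Require Import sesquilinear.
From mathcomp Require Import all_classical all_reals all_analysis.
From mathcomp Require Import ring lra.

Set Implicit Arguments.
Unset Strict Implicit.
Unset Printing Implicit Defensive.

Import Order.TTheory GRing.Theory Num.Theory.
Import numFieldNormedType.Exports.

Local Open Scope classical_set_scope.
Local Open Scope ring_scope.

Section SymmetricForms.
Variables (R : realType) (H : lmodType R).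
Implicit Types (a b : {symmetric H}) (u v : H).

Lemma symmetric_formC b u v : b u v = b v u.
Proof. by rewrite hermC expr0 mul1r. Qed.

(** Expanding the form at [u + v] and [u - v] bounds [b u v] from both sides. This replaces
    Cauchy-Schwarz by a bound without square roots. *)
Lemma psd_form_norm_le b u v :
  psd_form b -> `|b u v| <= (b u u + b v v) / 2.
Proof.
move=> b_psd; have := b_psd (u + v); have := b_psd (u - v).
by rewrite hnormB hnormD /= expr0 mul1r ler_norml => *; apply/andP; split; lra.
Qed.

(** Nonnegativity at [u - v / 2]. The small weight 1/4 on [b v v] lets that term be absorbed in
    [galerkin_perturb_bound]. *)
Lemma psd_form_half_le b u v :
  psd_form b -> b u v <= b u u + b v v / 4.
Proof.
move=> b_psd; have := b_psd (u - 2^-1 *: v).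
rewrite hnormB /= expr0 mul1r linearZl_LR !linearZr_LR /GRing.scale /=; lra.
Qed.

Section ParamForm.
Variables (n : nat) (b0 : {symmetric H}) (b : 'I_n -> {symmetric H}).
Implicit Types sigma : 'cV[R]_n.

Lemma param_formC sigma u v :
  param_form b0 b sigma u v = param_form b0 b sigma v u.
Proof.
rewrite /param_form symmetric_formC; congr (_ + _).
by apply: eq_bigr => i _; rewrite symmetric_formC.
Qed.

Lemma param_form_scalar sigma u : scalar (param_form b0 b sigma u).
Proof.
move=> c x y; rewrite /param_form linearPr /= mulrDr mulr_sumr addrACA.
congr (_ + _); rewrite -big_split; apply: eq_bigr => i _ /=.
by rewrite linearPr /= mulrDr mulrCA.
Qed.

Lemma param_form_bilinear sigma :
  bilinear_for *%R (idfun \; *%R) (param_form b0 b sigma).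
Proof.
split=> [v|u] c x y; last exact: param_form_scalar.
by rewrite ![param_form _ _ _ _ v]param_formC param_form_scalar.
Qed.

(** Together with the Hermitian instance below, this makes b_sigma a [{symmetric H}], so that
    everything shown for a single symmetric form applies to it. *)
HB.instance Definition _ sigma :=
  @bilinear_isBilinear.Build R H H R *%R (idfun \; *%R)
    (param_form b0 b sigma) (param_form_bilinear sigma).

Lemma param_form_hermitian sigma u v :
  param_form b0 b sigma u v =
  (-1) ^+ false * idfun (param_form b0 b sigma v u).
Proof. by rewrite expr0 mul1r param_formC. Qed.

HB.instance Definition _ sigma :=
  @isHermitianSesquilinear.Build R H false idfun
    (param_form b0 b sigma) (@param_form_hermitian sigma).

(** The perturbed point is written as [shift sigma] produces it in the difference quotient. *)
Lemma param_form_shift sigma i h u v :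
  param_form b0 b (h *: delta_mx i 0 + sigma) u v =
  param_form b0 b sigma u v + h * b i u v.
Proof.
rewrite /param_form -addrA; congr (_ + _).
rewrite (bigD1 i) // [in RHS](bigD1 i) //= !mxE !eqxx mulr1.
rewrite mulrDl addrC [h * _ + _]addrC addrA; congr (_ + _); rewrite addrC.
congr (_ + _); apply: eq_bigr => j /negPf ji.
by rewrite !mxE ji mulr0 add0r.
Qed.

Hypotheses (b0_psd : psd_form b0) (b_psd : forall i, psd_form (b i)).
Variable sigma : 'cV[R]_n.
Hypothesis sigma_gt0 : forall i, 0 < sigma i 0.

Let term_ge0 v i : 0 <= sigma i 0 * b i v v.
Proof. by rewrite mulr_ge0 ?b_psd // ltW. Qed.

Lemma param_form_psd : psd_form (param_form b0 b sigma).
Proof. by move=> v; rewrite addr_ge0 ?b0_psd// sumr_ge0. Qed.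

Lemma param_form_ge i v : sigma i 0 * b i v v <= param_form b0 b sigma v v.
Proof.
rewrite /param_form (bigD1 i) //= addrCA lerDl addr_ge0 ?b0_psd//.
by rewrite sumr_ge0.
Qed.

(* A sum of nonnegative terms vanishes only termwise, so the null vectors of
   the form do not depend on the positive weights. *)
Lemma param_form_eq0 tau v :
  param_form b0 b sigma v v = 0 -> param_form b0 b tau v v = 0.
Proof.
move=> bv0.
have biv0 i : b i v v = 0.
  apply/eqP; rewrite eq_le b_psd andbT.
  by rewrite -(pmulr_rle0 _ (sigma_gt0 i)) -bv0 param_form_ge.
have sum0 (rho : 'cV[R]_n) : \sum_i rho i 0 * b i v v = 0.
  by apply: big1 => i _; rewrite biv0 mulr0.
by move: bv0; rewrite /param_form !sum0.
Qed.

End ParamForm.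
End SymmetricForms.

Section Galerkin.
Variables (R : realType) (H : lmodType R) (N : nat).
Variables (V : submodClosed H) (Lam : 'I_N -> H).

Lemma stiffness_mx_form (a : {symmetric H}) (x y : 'cV[R]_N) :
  (x^T *m stiffness_mx Lam a *m y) 0 0 =
  a (\sum_j x j 0 *: Lam j) (\sum_j y j 0 *: Lam j).
Proof.
rewrite linear_sumr mxE; apply: eq_bigr => k _.
rewrite linear_sumlz mxE mulr_suml; apply: eq_bigr => j _.
by rewrite !mxE [RHS]linearZl_LR linearZr_LR /= mulrCA mulrC.
Qed.

Lemma load_vec_form (l : {scalar H}) (x : 'cV[R]_N) :
  (x^T *m load_vec Lam l) 0 0 = l (\sum_j x j 0 *: Lam j).
Proof.
rewrite linear_sum mxE; apply: eq_bigr => j _.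
by rewrite !mxE scalarZ.
Qed.

Hypothesis Lam_basis : is_basis V Lam.

Lemma basis_sum_mem (x : 'cV[R]_N) : \sum_j x j 0 *: Lam j \in V.
Proof.
by case: Lam_basis => LamV _ _; apply: rpred_sum => j _; rewrite rpredZ.
Qed.

(** If [x] is in the left kernel, the combination of basis vectors with coefficients [x] has zero
    energy, hence vanishes, and linear independence gives [x = 0]. *)
Lemma stiffness_mx_unit (a : {symmetric H}) :
  (forall v, a v v = 0 -> v = 0) -> stiffness_mx Lam a \in unitmx.
Proof.
move=> a_def; rewrite -row_free_unit; apply: inj_row_free => x xA0.
case: Lam_basis => _ Lam_free _.
have /a_def/Lam_free x0 :
    a (\sum_j x^T j 0 *: Lam j) (\sum_j x^T j 0 *: Lam j) = 0.
  by rewrite -stiffness_mx_form trmxK xA0 mul0mx mxE.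
by apply/rowP => j; have := x0 j; rewrite !mxE.
Qed.

(** Solving the linear system with the load vector as right-hand side exhibits a solution, so [xget]
    returns a solution rather than its default 0. *)
Lemma galerkin_solutionP (a : {symmetric H}) (l : {scalar H}) :
  (forall v, a v v = 0 -> v = 0) ->
  is_galerkin_solution V a l (galerkin_solution V a l).
Proof.
move=> a_def; have A_unit := stiffness_mx_unit a_def.
pose x := invmx (stiffness_mx Lam a) *m load_vec Lam l.
apply: (@xgetPex _ 0 [set u | is_galerkin_solution V a l u]).
exists (\sum_j x j 0 *: Lam j); split=> [|v]; first exact: basis_sum_mem.
case: Lam_basis => _ _ /[apply] -[c ->].
have -> : \sum_j c j *: Lam j = \sum_j (\col_j c j) j 0 *: Lam j.
  by apply: eq_bigr => j _; rewrite mxE.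
rewrite symmetric_formC -stiffness_mx_form -load_vec_form.
by rewrite -mulmxA /x mulKVmx.
Qed.

End Galerkin.

Section Perturbation.
Variables (R : realType) (H : lmodType R) (V : submodClosed H).
Variables (n : nat) (b0 : {symmetric H}) (b : 'I_n -> {symmetric H}).
Variables (sigma : 'cV[R]_n) (i : 'I_n) (h : R).
Let a := param_form b0 b sigma.
Let a' := param_form b0 b (h *: delta_mx i 0 + sigma).

(** The functional [r] is kept general because the identity serves twice: for the difference
    quotient, and with b_i(w, .) in place of [r] for its convergence. *)
Lemma galerkin_perturb (l r : {scalar H}) (u u' w : H) :
    is_galerkin_solution V a l u -> is_galerkin_solution V a' l u' ->
    is_galerkin_solution V a r w ->
  r (u' - u) = - (h * b i u' w).
Proof.
move=> [uV ul] [u'V u'l] [wV wr].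
have u'uV : u' - u \in V by rewrite -scaleN1r rpredD ?rpredZ.
rewrite -wr // /a param_formC linearBl /= -/a ul //.
by have := u'l _ wV; rewrite /a' param_form_shift -/a => <-; ring.
Qed.

(** Testing both equations with [u'] gives a(u', u') + h b_i(u', u') = a(u, u'), which is at most
    a(u, u) + a(u', u') / 4. Since a(u', u') >= sigma_i b_i(u', u') and h >= - sigma_i / 2, a
    coefficient 3/4 - 1/2 = 1/4 of sigma_i b_i(u', u') remains on the left. *)
Lemma galerkin_perturb_bound (l : {scalar H}) (u u' : H) :
    psd_form b0 -> (forall j, psd_form (b j)) -> (forall j, 0 < sigma j 0) ->
    `|h| <= sigma i 0 / 2 ->
    is_galerkin_solution V a l u -> is_galerkin_solution V a' l u' ->
  b i u' u' <= 4 * a u u / sigma i 0.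
Proof.
move=> b0_psd b_psd sigma_gt0 h_le [uV ul] [u'V u'l].
have := u'l _ u'V; rewrite -ul // /a' param_form_shift -/a => u'u'.
have := psd_form_half_le u u' (param_form_psd b0_psd b_psd sigma_gt0).
rewrite /= -/a => uu'.
have := param_form_ge b0_psd b_psd sigma_gt0 i u'; rewrite -/a => bu'.
have bi_ge0 := b_psd i u'.
have : - (sigma i 0 / 2) * b i u' u' <= h * b i u' u'.
  by rewrite ler_wpM2r // lerNl (le_trans _ h_le) // -normrN ler_norm.
by rewrite ler_pdivlMr //; lra.
Qed.

End Perturbation.

Theorem corollary2 (R : realType) (H : completeNormedModType R)
    (ip : {dot H for idfun})
    (H_hilbert : forall u : H, `|u| ^+ 2 = ip u u)
    (n : nat) (b0 : {symmetric H}) (b : 'I_n -> {symmetric H})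
    (b0_bounded : bounded_form b0) (b_bounded : forall i, bounded_form (b i))
    (b0_psd : psd_form b0) (b_psd : forall i, psd_form (b i))
    (beta C : R) (beta_gt0 : 0 < beta) (C_gt0 : 0 < C)
    (b_one_bounds : forall v : H,
       beta * `|v| ^+ 2 <= param_form b0 b (const_mx 1) v v <= C * `|v| ^+ 2)
    (V : submodClosed H) (N : nat) (Lam : 'I_N -> H)
    (Lam_basis : is_basis V Lam)
    (l r : {scalar H}) (l_cont : continuous l) (r_cont : continuous r)
    (sigma : 'cV[R]_n) (sigma_gt0 : forall i, 0 < sigma i 0)
    (laml lamr : 'cV[R]_N)
    (laml_def : galerkin_solution V (param_form b0 b sigma) l
                = \sum_j laml j 0 *: Lam j)
    (lamr_def : galerkin_solution V (param_form b0 b sigma) r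
                = \sum_j lamr j 0 *: Lam j) :
  [/\ measurement b0 b V l r sigma
        = (laml^T *m stiffness_mx Lam (param_form b0 b sigma) *m lamr) 0 0,
      (laml^T *m stiffness_mx Lam (param_form b0 b sigma) *m lamr) 0 0
        = (laml^T *m load_vec Lam r) 0 0
    & forall i : 'I_n,
        is_derive sigma (delta_mx i 0) (measurement b0 b V l r)
          (- (laml^T *m stiffness_mx Lam (b i) *m lamr) 0 0)].
Proof.
pose a := param_form b0 b sigma.
(* Coercivity is assumed only at the weights 1; null vectors at [tau] are null there too, so
   definiteness holds at [sigma] and at all nearby points. *)
have def (tau : 'cV[R]_n) : (forall i, 0 < tau i 0) ->
    forall v, param_form b0 b tau v v = 0 -> v = 0.
  move=> tau_gt0 v /(param_form_eq0 b0_psd b_psd tau_gt0 (const_mx 1)) v0.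
  have := b_one_bounds v; rewrite v0 => /andP[+ _].
  rewrite pmulr_rle0 // => v_le0; apply/eqP; rewrite -normr_eq0 -sqrf_eq0.
  by rewrite eq_le v_le0 sqr_ge0.
have solP (tau : 'cV[R]_n) (f : {scalar H}) : (forall i, 0 < tau i 0) ->
    is_galerkin_solution V (param_form b0 b tau) f
      (galerkin_solution V (param_form b0 b tau) f).
  by move=> tau_gt0; apply: (galerkin_solutionP Lam_basis); exact: def.
set u := galerkin_solution _ _ l in laml_def.
set w := galerkin_solution _ _ r in lamr_def.
have ul : is_galerkin_solution V a l u by exact: solP.
have wr : is_galerkin_solution V a r w by exact: solP.
have auw : a u w = r u by rewrite /a param_formC -/a wr.2 // ul.1.
split; first by rewrite stiffness_mx_form -laml_def -lamr_def /= -/a auw.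
  by rewrite stiffness_mx_form load_vec_form -laml_def -lamr_def.
move=> i; rewrite stiffness_mx_form -laml_def -lamr_def.
(* b_i(w, .) is packed as a linear functional so that it can be the right-hand side of a Galerkin
   problem. *)
pose biw : {scalar H} := HB.pack (b i w : H -> R)
  (@GRing.isLinear.Build R H R *%R (b i w) (linearPr (b i) w)).
set z := galerkin_solution V a biw.
have zbw : is_galerkin_solution V a biw z by exact: solP.
(* [K] bounds |b_i(u', z)| independently of h: it is the bound of [psd_form_norm_le] with b_i(u',
   u') replaced by its uniform estimate. *)
pose K := (4 * a u u / sigma i 0 + b i z z) / 2.
have K_ge0 : 0 <= K.
  rewrite divr_ge0 // addr_ge0 ?b_psd // divr_ge0 ?(ltW (sigma_gt0 i)) //.
  by rewrite mulr_ge0 // (param_form_psd b0_psd b_psd sigma_gt0).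
suff cvgF : h^-1 *: ((measurement b0 b V l r \o shift sigma)
      (h *: delta_mx i 0) - measurement b0 b V l r sigma)
    @[h --> 0^'] --> - b i u w.
  by apply: DeriveDef; [apply/cvg_ex; eexists; exact: cvgF | exact/cvg_lim].
apply/cvgrPdist_le => e e_gt0; near=> h.
have h_neq0 : h != 0 by near: h; exact: nbhs_dnbhs_neq.
have h_le : `|h| <= sigma i 0 / 2.
  by near: h; apply: dnbhs0_le; rewrite divr_gt0.
(* The added 1 keeps the denominator positive when [K] is 0, and |h| K is still at most e. *)
have hK : `|h| <= e / (K + 1).
  by near: h; apply: dnbhs0_le; rewrite divr_gt0 // ltr_wpDl.
(* Since |h| <= sigma_i / 2, the perturbed weights stay positive and [solP] applies to them. *)
have tau_gt0 j : 0 < (h *: delta_mx i 0 + sigma) j 0.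
  rewrite !mxE; have := sigma_gt0 j; have [->|_] := eqVneq j i => /=.
    by move: h_le; rewrite mulr1 ler_norml => /andP[]; lra.
  by rewrite mulr0 add0r.
set u' := galerkin_solution V (param_form b0 b (h *: delta_mx i 0 + sigma)) l.
have u'l : is_galerkin_solution V
    (param_form b0 b (h *: delta_mx i 0 + sigma)) l u' by exact: solP.
(* For h nonzero the difference quotient equals - b_i(u', w) exactly. *)
have -> : h^-1 *: ((measurement b0 b V l r \o shift sigma)
    (h *: delta_mx i 0) - measurement b0 b V l r sigma) = - b i u' w.
  rewrite /= /measurement -/u -/u' -linearB (galerkin_perturb ul u'l wr).
  by rewrite scalerN /GRing.scale /= mulKf.
have -> : - b i u w - - b i u' w = biw (u' - u).
  by rewrite linearB /= ![b i w _]symmetric_formC; ring.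
rewrite (galerkin_perturb ul u'l zbw) normrN normrM.
have := psd_form_norm_le u' z (b_psd i).
have := galerkin_perturb_bound b0_psd b_psd sigma_gt0 h_le ul u'l.
rewrite -/a => u'_le bu'z.
have {}bu'z : `|b i u' z| <= K by rewrite /K; lra.
rewrite (le_trans (ler_pM _ _ hK bu'z)) // -mulrA ler_piMr ?ltW //.
by rewrite mulrC ltr_pdivrMr ?mul1r ?ltrDl // ltr_wpDl.
Unshelve. all: by end_near. Qed.
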